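(* Suppose that the generation cost function $G:\mathcal{G}\to\mathbb{R}$ and the battery cost function $D:\mathcal{D}\to\mathbb{R}$ are convex over convex domains $\mathcal{G}\subseteq\mathbb{R}_{+}^{|\mathcal{T}|}$ and $\mathcal{D}\subseteq\mathbb{R}_{+}^{|\mathcal{T}|}\times\mathbb{R}_{+}^{|\mathcal{T}|}$. Then the prosumption cost function $$F(x):=\max_{p\in\mathcal{P}}\ \min_{(g,\delta,q)\in\mathcal{F}(x;p)}\Bigl\{G(g)+D(\delta)\Bigr\}$$ is convex over the convex domain $$\mathcal{X}:=\bigl\{x\in\mathbb{R}^{|\mathcal{T}|\times|\mathcal{B}|} : \mathcal{F}(x;p)\neq\emptyset \ \text{ for all } p\in\mathcal{P}\bigr\},$$ where $\mathcal{F}(x;p)$ is the feasible domain of the dispatchable variables $(g,\delta,q)$ defined in the context.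
   Context: $\mathcal{T}$ and $\mathcal{B}$ are finite nonempty index sets (time spots and buses). A spatio-temporal prosumption profile is $x=(x^{(1)},\ldots,x^{(|\mathcal{B}|)})$ with $x^{(i)}=(x^{(i)}_t)_{t\in\mathcal{T}}\in\mathbb{R}^{|\mathcal{T}|}$, regarded as an element of $\mathbb{R}^{|\mathcal{T}|\times|\mathcal{B}|}$. The load profile $l\in\mathbb{R}_{+}^{|\mathcal{T}|}$ is a given constant vector, and $\eta^{\rm in},\eta^{\rm out}\in(0,1]$ are given constants. The renewable scenario set is $\mathcal{P}=\{p^{(1)},\ldots,p^{(m)}\}\subset\mathbb{R}_{+}^{|\mathcal{T}|}$, finite and nonempty. $\mathcal{G}\subseteq\mathbb{R}_{+}^{|\mathcal{T}|}$ is the domain of dispatchable generation profiles $g$, and $\mathcal{D}\subseteq\mathbb{R}_{+}^{|\mathcal{T}|}\times\mathbb{R}_{+}^{|\mathcal{T}|}$ is the domain of battery profiles $\delta=(\delta^{\rm in},\delta^{\rm out})$. For $p\in\mathcal{P}$, the set of curtailment profiles is $\mathcal{Q}(p):=\{q\in\mathbb{R}^{|\mathcal{T}|}: 0\le q\le p\}$ (element-wise inequalities). The energy balance equation is $$\sum_{i=1}^{|\mathcal{B}|}x^{(i)}_{t}=g_{t}-l_{t}+p_{t}-q_{t}+\eta^{\rm out}\delta^{\rm out}_{t}-\frac{1}{\eta^{\rm in}}\delta^{\rm in}_{t},\qquad t\in\mathcal{T},$$ and for $x\in\mathbb{R}^{|\mathcal{T}|\times|\mathcal{B}|}$ and $p\in\mathcal{P}$,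 $$\mathcal{F}(x;p):=\bigl\{(g,\delta,q)\in\mathcal{G}\times\mathcal{D}\times\mathcal{Q}(p) : \text{the energy balance equation holds}\bigr\}.$$ The minima in the definition of $F$ are assumed to exist for all $x\in\mathcal{X}$ and $p\in\mathcal{P}$, so that $F:\mathcal{X}\to\mathbb{R}$ is well defined. *)

(* Defs.v *)
From HB Require Import structures.
From mathcomp Require Import all_boot all_order all_algebra.
From mathcomp Require Import boolp classical_sets functions cardinality reals.
From mathcomp Require Import interval_inference convex.

Set Implicit Arguments.
Unset Strict Implicit.
Unset Printing Implicit Defensive.

Import Order.TTheory GRing.Theory Num.Theory.

Local Open Scope classical_set_scope.
Local Open Scope ring_scope.

(* The codomain is [R^o] rather than [R] only so that profiles form an
   [lmodType R]. *)
Notation profile R T := {ffun T -> R^o}.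

(* [x i t] is the prosumption at bus [i] and time spot [t]. *)
Notation prosumption R T B := {ffun B -> {ffun T -> R^o}}.

Definition is_min (R : realType) (A : set R) (m : R) : Prop :=
  A m /\ lbound A m.

Definition is_max (R : realType) (A : set R) (m : R) : Prop :=
  A m /\ ubound A m.

(* [minimum A] and [maximum A] are the actual minimum and maximum when these
   are attained, and the junk value [0] otherwise. *)
Definition minimum (R : realType) (A : set R) : R := xget 0 (is_min A).

Definition maximum (R : realType) (A : set R) : R := xget 0 (is_max A).

Definition nonneg_profile (R : realType) (T : finType) (v : profile R T) :
    Prop :=
  forall t : T, 0 <= (v t : R).

Definition curtailments (R : realType) (T : finType) (p : profile R T) :
    set (profile R T) :=
  [set q | forall t : T, 0 <= (q t : R) /\ (q t : R) <= (p t : R)].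

(* A battery profile is a pair [delta = (delta_in, delta_out)]. *)
Definition energy_balance (R : realType) (T B : finType) (l : profile R T)
    (eta_in eta_out : R) (x : prosumption R T B) (p g : profile R T)
    (delta : profile R T * profile R T) (q : profile R T) : Prop :=
  forall t : T,
    \sum_(i : B) (x i t : R) =
      (g t : R) - (l t : R) + (p t : R) - (q t : R)
      + eta_out * (delta.2 t : R) - 1 / eta_in * (delta.1 t : R).

(* Dispatchable variables are encoded as triples [z = (g, delta, q)], that is
   [z.1.1 = g], [z.1.2 = delta] and [z.2 = q]. *)
Definition feasible (R : realType) (T B : finType) (l : profile R T)
    (eta_in eta_out : R) (calG : set (profile R T))
    (calD : set (profile R T * profile R T))
    (x : prosumption R T B) (p : profile R T) :
    set (profile R T * (profile R T * profile R T) * profile R T) :=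
  [set z | [/\ calG z.1.1, calD z.1.2, curtailments p z.2
             & energy_balance l eta_in eta_out x p z.1.1 z.1.2 z.2]].

Definition costs (R : realType) (T B : finType) (l : profile R T)
    (eta_in eta_out : R) (calG : set (profile R T))
    (calD : set (profile R T * profile R T))
    (G : profile R T -> R) (D : profile R T * profile R T -> R)
    (x : prosumption R T B) (p : profile R T) : set R :=
  [set G z.1.1 + D z.1.2 | z in feasible l eta_in eta_out calG calD x p].

Definition prosumption_domain (R : realType) (T B : finType) (l : profile R T)
    (eta_in eta_out : R) (P : set (profile R T)) (calG : set (profile R T))
    (calD : set (profile R T * profile R T)) : set (prosumption R T B) :=
  [set x | forall p, P p -> feasible l eta_in eta_out calG calD x p !=set0].

(* The cost function is total; only its values on [prosumption_domain] are
   meaningful. *)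
Definition prosumption_cost (R : realType) (T B : finType) (l : profile R T)
    (eta_in eta_out : R) (P : set (profile R T)) (calG : set (profile R T))
    (calD : set (profile R T * profile R T))
    (G : profile R T -> R) (D : profile R T * profile R T -> R)
    (x : prosumption R T B) : R :=
  maximum [set minimum (costs l eta_in eta_out calG calD G D x p) | p in P].

(* Main.v *)
Require Import Defs.
From HB Require Import structures.
From mathcomp Require Import all_boot all_order all_algebra.
From mathcomp Require Import boolp classical_sets functions cardinality reals.
From mathcomp Require Import interval_inference convex.
From mathcomp Require Import ring.

(** The cost of a profile is a maximum of optimal values of convex programs,
    and both operations preserve convexity.

    For a fixed scenario [p], the balance equation is affine in [x] and in the
    dispatchable variables together, and the constraints on [g], [delta] and
    [q] are convex. A convex combination of a dispatch serving [x] and a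
    dispatch serving [y] therefore serves the convex combination of [x] and
    [y] ([feasible_conv]). This gives the convexity of the domain. Applied to
    optimal dispatches for [x] and [y], it also gives the convexity of the
    optimal value: the combined dispatch is feasible, and by convexity of [G]
    and [D] its cost is at most the combination of the two optimal costs
    ([convex_function_minimum]). Finally a pointwise maximum over finitely many
    scenarios of convex functions is convex ([convex_function_maximum]). *)

Import Order.TTheory GRing.Theory Num.Theory.

Local Open Scope classical_set_scope.
Local Open Scope ring_scope.
Local Open Scope convex_scope.

Lemma minimumP (R : realType) (A : set R) :
  (exists m, is_min A m) -> is_min A (minimum A).
Proof. exact: xgetPex. Qed.

(** A finite nonempty set attains its maximum: a [\big[max/a]] over its elements
    started at a member [a] stays in the set. *)
Lemma maximumP (R : realType) (A : set R) :
  finite_set A -> A !=set0 -> is_max A (maximum A).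
Proof.
move=> /finite_seqP[s ->] [a /= a_s]; apply: xgetPex.
exists (\big[Order.max/a]_(b <- s) b); split => /=; last first.
  by move=> b /= b_s; apply: le_bigmax_seq b_s _.
rewrite big_seq; elim/big_ind: _ => // b c b_s c_s.
by rewrite /Order.max; case: ifP.
Qed.

Lemma convR_homo (R : realType) (t : {i01 R}) (a b c d : R) :
  a <= c -> b <= d -> (a : R^o) <| t |> b <= (c : R^o) <| t |> d.
Proof.
move=> ac bd; rewrite !convRE; apply: lerD; apply: ler_wpM2l => //.
by rewrite subr_ge0.
Qed.

(** Partial minimization preserves convexity. The hypothesis on [Z] says that
    its graph is convex; the combination of a minimizer over [Z x] and a
    minimizer over [Z y] is thus a competitor over [Z (x <| t |> y)]. *)
Lemma convex_function_minimum (R : realType) (E F : lmodType R)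
    (X : set (convex_lmodType E))
    (Z : convex_lmodType E -> set (convex_lmodType F))
    (C : set (convex_lmodType F)) (f : convex_lmodType F -> R) :
  convex_set X -> convex_function C f -> (forall x, Z x `<=` C) ->
  (forall t x y z w, Z x z -> Z y w -> Z (x <| t |> y) (z <| t |> w)) ->
  (forall x, X x -> exists m, is_min (f @` Z x) m) ->
  convex_function X (fun x => minimum (f @` Z x)).
Proof.
move=> Xconv fconv ZC Zconv Zmin t x y xX yX.
have /set_mem/Zmin/minimumP[_ xy_lb] := Xconv x y t xX yX.
have /set_mem/Zmin/minimumP[[z Zxz <-] _] := xX.
have /set_mem/Zmin/minimumP[[w Zyw <-] _] := yX.
apply: (@le_trans _ _ (f (z <| t |> w))).
  by apply: xy_lb; exists (z <| t |> w) => //; exact: Zconv.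
by apply: fconv; apply/mem_set; [exact: ZC Zxz | exact: ZC Zyw].
Qed.

(** The maximum at [x <| t |> y] is attained by some [i], and the convexity of
    [f i] together with [f i <= maximum] at [x] and at [y] bounds it. *)
Lemma convex_function_maximum (R : realType) (E : lmodType R) (I : Type)
    (X : set (convex_lmodType E)) (P : set I)
    (f : I -> convex_lmodType E -> R) :
  finite_set P -> P !=set0 -> (forall i, P i -> convex_function X (f i)) ->
  convex_function X (fun x => maximum [set f i x | i in P]).
Proof.
move=> Pfin [i0 Pi0] fconv t x y xX yX.
have maxP z : is_max [set f i z | i in P] (maximum [set f i z | i in P]).
  by apply: maximumP; [exact: finite_image | exists (f i0 z), i0].
have [[i Pi <-] _] := maxP (x <| t |> y).
apply: le_trans (fconv i Pi t x y xX yX) _.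
by apply: convR_homo; apply: (maxP _).2; exists i.
Qed.

Lemma conv_profileE (R : realType) (T : finType) (s : {i01 R})
    (u v : convex_lmodType (profile R T)) (t : T) :
  (u <| s |> v : profile R T) t =
  s%:num * (u : profile R T) t + (1 - s%:num) * (v : profile R T) t.
Proof. by rewrite /conv/= !ffunE. Qed.

Lemma curtailments_convex (R : realType) (T : finType) (p : profile R T) :
  convex_set (curtailments p).
Proof.
move=> q r s /set_mem qp /set_mem rp; apply/mem_set => t.
have [[q0 qp_t] [r0 rp_t]] := (qp t, rp t); rewrite conv_profileE; split.
  by rewrite addr_ge0// mulr_ge0// subr_ge0.
(* The constant bound [p t] is its own convex combination. *)
have -> : p t = ((p t : R^o) <| s |> (p t : R^o)) by rewrite convmm.
exact: convR_homo.
Qed.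

(** Both sides of the balance equation are affine in [(x, g, delta, q)]; the
    constant terms [l] and [p] survive because the weights sum to one. *)
Lemma energy_balance_conv (R : realType) (T B : finType) (l : profile R T)
    (eta_in eta_out : R) (p : profile R T) (s : {i01 R})
    (x x' : convex_lmodType (prosumption R T B))
    (g g' : convex_lmodType (profile R T))
    (delta delta' : convex_lmodType (profile R T * profile R T)%type)
    (q q' : convex_lmodType (profile R T)) :
  energy_balance l eta_in eta_out x p g delta q ->
  energy_balance l eta_in eta_out x' p g' delta' q' ->
  energy_balance l eta_in eta_out (x <| s |> x') p
    (g <| s |> g') (delta <| s |> delta') (q <| s |> q').
Proof.
move=> bal bal' t.
have -> : \sum_i ((x <| s |> x' : prosumption R T B) i t : R) =
    s%:num * (\sum_i ((x : prosumption R T B) i t : R)) +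
    (1 - s%:num) * (\sum_i ((x' : prosumption R T B) i t : R)).
  rewrite !mulr_sumr -big_split; apply: eq_bigr => i _ /=.
  by rewrite /conv/= !ffunE.
rewrite (bal t) (bal' t) !conv_profileE; ring.
Qed.

Local Notation dispatch R T :=
  (profile R T * (profile R T * profile R T) * profile R T)%type.

Lemma feasible_conv (R : realType) (T B : finType) (l : profile R T)
    (eta_in eta_out : R) (calG : set (profile R T))
    (calD : set (profile R T * profile R T)) (p : profile R T) (s : {i01 R})
    (x y : convex_lmodType (prosumption R T B))
    (z w : convex_lmodType (dispatch R T)) :
  convex_set calG -> convex_set calD ->
  feasible l eta_in eta_out calG calD x p z ->
  feasible l eta_in eta_out calG calD y p w ->
  feasible l eta_in eta_out calG calD (x <| s |> y) p (z <| s |> w).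
Proof.
move=> Gconv Dconv [zG zD zq zbal] [wG wD wq wbal]; split.
- by apply/set_mem/Gconv; exact/mem_set.
- by apply/set_mem/Dconv; exact/mem_set.
- by apply/set_mem/curtailments_convex; exact/mem_set.
- exact: energy_balance_conv.
Qed.

Theorem proposition2 (R : realType) (T B : finType)
  (T_nonempty : (0 < #|T|)%N) (B_nonempty : (0 < #|B|)%N)
  (l : profile R T) (l_ge0 : nonneg_profile l)
  (eta_in eta_out : R)
  (eta_in_gt0 : 0 < eta_in) (eta_in_le1 : eta_in <= 1)
  (eta_out_gt0 : 0 < eta_out) (eta_out_le1 : eta_out <= 1)
  (P : set (profile R T))
  (P_finite : finite_set P) (P_nonempty : P !=set0)
  (P_ge0 : forall p, P p -> nonneg_profile p)
  (calG : set (profile R T))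
  (calG_ge0 : forall g, calG g -> nonneg_profile g)
  (calD : set (profile R T * profile R T))
  (calD_ge0 : forall delta, calD delta ->
     nonneg_profile delta.1 /\ nonneg_profile delta.2)
  (G : profile R T -> R) (D : profile R T * profile R T -> R)
  (calG_convex : convex_set calG) (G_convex : convex_function calG G)
  (calD_convex : convex_set calD) (D_convex : convex_function calD D)
  (minima_exist : forall x : prosumption R T B,
     prosumption_domain l eta_in eta_out P calG calD x ->
     forall p, P p ->
       exists m : R, is_min (costs l eta_in eta_out calG calD G D x p) m) :
  convex_set (prosumption_domain l eta_in eta_out P calG calD
                : set (prosumption R T B)) /\
  convex_function (prosumption_domain l eta_in eta_out P calG calD
                     : set (prosumption R T B))
    (prosumption_cost l eta_in eta_out P calG calD G D).
Proof.
have Xconv : convex_set (prosumption_domain l eta_in eta_out P calG calD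
    : set (prosumption R T B)).
  move=> x y s /set_mem xX /set_mem yX; apply/mem_set => p Pp.
  have [z xz] := xX p Pp; have [w yw] := yX p Pp.
  by exists ((z : convex_lmodType (dispatch R T)) <| s |> w);
     exact: feasible_conv.
split=> //; apply: convex_function_maximum => // p Pp.
apply: (@convex_function_minimum R (prosumption R T B)
  (dispatch R T) _
  (fun x => feasible l eta_in eta_out calG calD x p)
  [set z | calG z.1.1 /\ calD z.1.2]
  (fun z => G z.1.1 + D z.1.2)) => //.
- move=> s z w /set_mem[zG zD] /set_mem[wG wD].
  have Gle := G_convex s _ _ (mem_set zG) (mem_set wG).
  have Dle := D_convex s _ _ (mem_set zD) (mem_set wD).
  apply: le_trans (lerD Gle Dle) _.
  by rewrite !convRE !mulrDr addrACA.
- by move=> x z [].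
- by move=> s x y z w; exact: feasible_conv.
- by move=> x xX; exact: minima_exist.
Qed.
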